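(* Consider the lossless power flow equations (PF) of a power network $(\mathcal N,\mathcal E)$ (defined in the context) and assume the network is radial. Let $\mathsf D$ and $\mathsf S$ be the branch and nodal stiffness matrices, $p=(p_{\ell\ell},p_{g\ell},p_{gg})$ the branch-wise active power flows, and $|A|_L^{\ell\ell}$ the load–load block of the unoriented incidence matrix. Define $$\Delta=\left\|\mathsf S^{-1}\left(Q_L-4|A|_L^{\ell\ell}\mathsf D_{\ell\ell}^{-1}[p_{\ell\ell}]p_{\ell\ell}\right)\right\|_\infty,$$ $$\Gamma_{\ell\ell}=\|\mathsf D_{\ell\ell}^{-1}p_{\ell\ell}\|_\infty,\qquad \Gamma_{g\ell}=\|\mathsf D_{g\ell}^{-1}p_{g\ell}\|_\infty,\qquad \Gamma_{gg}=\|\mathsf D_{gg}^{-1}p_{gg}\|_\infty.$$ If $$\Delta+4\Gamma_{g\ell}^2<1,\qquad \Gamma_{\ell\ell}<\tfrac14,\qquad \Gamma_{gg}<1,$$ then (PF) possesses a solution $(\theta,V_L)$ satisfying, with $\eta_{ij}=\theta_i-\theta_j$, the bounds $$v_+\le V_i/V_i^*\le1\ (i\in\mathcal N_L),\qquad |\eta_{ij}|\le\gamma_{\ell\ell}\ ((i,j)\in\mathcal E^{\ell\ell}),\qquad |\eta_{ij}|\le\gamma_{g\ell}\ ((i,j)\in\mathcal E^{g\ell}),\qquad |\eta_{ij}|\le\gamma_{gg}\ ((i,j)\in\mathcal E^{gg}),$$ where $v_+\in(\tfrac12,1]$ and $(\gamma_{\ell\ell},\gamma_{g\ell},\gamma_{gg})\in[0,\tfrac\pi2)\times[0,\tfrac\pi4)\times[0,\tfrac\pi2)$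 are defined by $$v_+=\sqrt{\tfrac12\left(1-\tfrac\Delta2+\sqrt{1-(\Delta+4\Gamma_{g\ell}^2)}\right)},\qquad \sin(\gamma_{\ell\ell})=\frac{\Gamma_{\ell\ell}}{v_+^2},\qquad \sin(\gamma_{g\ell})=\frac{\Gamma_{g\ell}}{v_+},\qquad \sin(\gamma_{gg})=\Gamma_{gg}.$$
   Context: **Network.** $(\mathcal N,\mathcal E)$ is a finite connected graph whose branches (edges) have each been given a direction. The buses (nodes) are partitioned as $\mathcal N=\mathcal N_L\cup\mathcal N_G$, with $\mathcal N_L=\{1,\dots,n\}$ the loads ($\mathsf{PQ}$ buses) and $\mathcal N_G=\{n+1,\dots,n+m\}$ the generators ($\mathsf{PV}$ buses), $n,m\ge1$. The branches are partitioned as $\mathcal E=\mathcal E^{\ell\ell}\cup\mathcal E^{g\ell}\cup\mathcal E^{gg}$: branches between two loads, between a generator and a load (all oriented from generator to load), and between two generators; orientations within $\mathcal E^{\ell\ell}$ and $\mathcal E^{gg}$ are arbitrary. The network is radial if it contains no cycles. **Susceptances.** Each branch $(i,j)\in\mathcal E$ has susceptance $b_{ij}=b_{ji}<0$ ($b_{ij}=0$ if $i,j$ are not joined by a branch), and each bus has a shunt susceptance $b_{\mathrm{shunt},i}\in\mathbb R$. The symmetric matrix $B\in\mathbb R^{(n+m)\times(n+m)}$ has $B_{ij}=-b_{ij}$ for $i\ne j$ and $B_{ii}=\sum_{j\ne i}b_{ij}+b_{\mathrm{shunt},i}$, with block partition $B=\begin{pmatrix} B_{LL} & B_{LG} \\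 B_{GL} & B_{GG} \end{pmatrix}$ according to loads and generators. It is assumed that $B_{LL}$ is negative definite. **Power flow equations (PF).** Each bus has a voltage magnitude $V_i>0$ and a phase angle $\theta_i\in\mathbb S^1$. Given data: $P_i\in\mathbb R$ for all $i$, with $\sum_{i=1}^{n+m}P_i=0$; $V_i>0$ for $i\in\mathcal N_G$ (vector $V_G$); $Q_i\le0$ for $i\in\mathcal N_L$ (vector $Q_L$). Unknowns: $\theta=(\theta_1,\dots,\theta_{n+m})$ and $V_L=(V_1,\dots,V_n)\in\mathbb R^n_{>0}$. The equations are $$P_i=\sum_{j=1}^{n+m}V_iV_jB_{ij}\sin(\theta_i-\theta_j)\ (i\in\mathcal N_L\cup\mathcal N_G),\qquad Q_i=-\sum_{j=1}^{n+m}V_iV_jB_{ij}\cos(\theta_i-\theta_j)\ (i\in\mathcal N_L).$$ Angle differences $\eta_{ij}=\theta_i-\theta_j$ are understood modulo $2\pi$ (with representatives in $(-\pi,\pi]$). **Incidence matrices and branch flows.** $A\in\mathbb R^{(n+m)\times|\mathcal E|}$ is the oriented incidence matrix: in the column of branch $(i,j)$ the entry is $+1$ in row $i$ (sending end), $-1$ in row $j$ (receiving end), and $0$ elsewhere. $|A|$ is the matrix of entrywise absolute values of $A$, and $|A|_L^{\ell\ell}$ is its block with rows $\mathcal N_L$ and columns $\mathcal E^{\ell\ell}$. For a radial network, $p=(A^{\mathsf T}A)^{-1}A^{\mathsf T}P$ is the unique vector with $P=Ap$; it is partitioned as $p=(p_{\ell\ell},p_{g\ell},p_{gg})$ according to the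 branch partition. **Stiffness matrices.** The open-circuit load voltages are $V_L^*=-B_{LL}^{-1}B_{LG}V_G\in\mathbb R^n_{>0}$, with entries $V_i^*$, $i\in\mathcal N_L$; for $i\in\mathcal N_G$ put $V_i^*=V_i$. The branch stiffness matrix $\mathsf D$ is the $|\mathcal E|\times|\mathcal E|$ diagonal matrix with entry $V_i^*V_j^*B_{ij}$ for branch $(i,j)$, with diagonal blocks $\mathsf D_{\ell\ell},\mathsf D_{g\ell},\mathsf D_{gg}$ according to the branch partition. The nodal stiffness matrix is $\mathsf S=\frac14\,\mathrm{diag}(V_L^* )\,B_{LL}\,\mathrm{diag}(V_L^* )$. **Notation.** For a vector $x$, $[x]=\mathrm{diag}(x)$; $\|\cdot\|_\infty$ is the max norm of a vector (equal to $0$ for an empty vector). *)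

(* Defs.v *)
From mathcomp Require Import all_boot all_order all_algebra.
From mathcomp Require Import lra.
From mathcomp Require Import all_classical all_reals all_analysis.

Set Implicit Arguments.
Unset Strict Implicit.
Unset Printing Implicit Defensive.

Import Order.TTheory GRing.Theory Num.Theory.
Import numFieldNormedType.Exports.

Local Open Scope ring_scope.

(* A bus is an index in 'I_(n + m): load i is [lshift m i] and generator g is
   [rshift n g].  A branch is an index in 'I_(kll + (kgl + kgg)), which makes
   the load-load, generator-load and generator-generator partitions block
   decompositions.  The pairs are (sending end, receiving end). *)
Record network (R : realType) (n m kll kgl kgg : nat) := Network {
  branch_ll : 'I_kll -> 'I_n * 'I_n;
  branch_gl : 'I_kgl -> 'I_m * 'I_n;
  branch_gg : 'I_kgg -> 'I_m * 'I_m;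
  susceptance : 'I_(n + m) -> 'I_(n + m) -> R;
  shunt : 'I_(n + m) -> R
}.

Definition ll_idx kll kgl kgg (e : 'I_kll) : 'I_(kll + (kgl + kgg)) :=
  lshift (kgl + kgg) e.
Definition gl_idx kll kgl kgg (e : 'I_kgl) : 'I_(kll + (kgl + kgg)) :=
  rshift kll (lshift kgg e).
Definition gg_idx kll kgl kgg (e : 'I_kgg) : 'I_(kll + (kgl + kgg)) :=
  rshift kll (rshift kgl e).
Arguments ll_idx {kll} kgl kgg e.
Arguments gl_idx kll {kgl} kgg e.
Arguments gg_idx kll kgl {kgg} e.

Section Network.
Variables (R : realType) (n m kll kgl kgg : nat).
Variable N : network R n m kll kgl kgg.

Local Notation bus := 'I_(n + m).
Local Notation branch := 'I_(kll + (kgl + kgg)).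

Definition send (e : branch) : bus :=
  match fintype.split e with
  | inl k => lshift m (branch_ll N k).1
  | inr e' => match fintype.split e' with
              | inl k => rshift n (branch_gl N k).1
              | inr k => rshift n (branch_gg N k).1
              end
  end.

Definition recv (e : branch) : bus :=
  match fintype.split e with
  | inl k => lshift m (branch_ll N k).2
  | inr e' => match fintype.split e' with
              | inl k => lshift m (branch_gl N k).2
              | inr k => rshift n (branch_gg N k).2
              end
  end.

Definition ends (e : branch) : {set bus} := [set send e; recv e].

Definition joined : rel bus := fun i j => [exists e, ends e == [set i; j]].

(* The graph is simple, since branches and susceptances are indexed by pairs
   of distinct buses. *)
Record network_axioms : Prop := NetworkAxioms {
  no_loop : forall e, send e != recv e;
  no_parallel : injective ends;
  graph_connected : forall i j, connect joined i j;
  susceptance_sym : forall i j, susceptance N i j = susceptance N j i;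
  susceptance_lt0 : forall i j, joined i j -> susceptance N i j < 0;
  susceptance_eq0 : forall i j, ~~ joined i j -> susceptance N i j = 0
}.

(* In a simple graph a cycle has at least three distinct nodes; a [ucycle]
   of size two only runs back and forth along one branch. *)
Definition radial : Prop :=
  forall c : seq bus, ucycle joined c -> (size c <= 2)%N.

Definition Bmx : 'M[R]_(n + m) :=
  \matrix_(i, j) if i == j
    then \sum_(k | k != i) susceptance N i k + shunt N i
    else - susceptance N i j.

Definition BLL : 'M[R]_n := ulsubmx Bmx.
Definition BLG : 'M[R]_(n, m) := ursubmx Bmx.

Definition incidence : 'M[R]_(n + m, kll + (kgl + kgg)) :=
  \matrix_(i, e) ((i == send e)%:R - (i == recv e)%:R).

Definition abs_incidence : 'M[R]_(n + m, kll + (kgl + kgg)) :=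
  map_mx Num.norm incidence.

Definition abs_incidence_Lll : 'M[R]_(n, kll) := ulsubmx abs_incidence.

Definition branch_flow (P : 'cV[R]_(n + m)) : 'cV[R]_(kll + (kgl + kgg)) :=
  invmx (incidence^T *m incidence) *m incidence^T *m P.

Definition p_ll (P : 'cV[R]_(n + m)) : 'cV[R]_kll := usubmx (branch_flow P).
Definition p_gl (P : 'cV[R]_(n + m)) : 'cV[R]_kgl :=
  usubmx (dsubmx (branch_flow P)).
Definition p_gg (P : 'cV[R]_(n + m)) : 'cV[R]_kgg :=
  dsubmx (dsubmx (branch_flow P)).

Definition VLstar (VG : 'cV[R]_m) : 'cV[R]_n := - (invmx BLL *m BLG *m VG).
Definition Vstar (VG : 'cV[R]_m) : 'cV[R]_(n + m) := col_mx (VLstar VG) VG.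

Definition Dmx (VG : 'cV[R]_m) : 'M[R]_(kll + (kgl + kgg)) :=
  diag_mx (\row_e (Vstar VG (send e) 0 * Vstar VG (recv e) 0
                   * Bmx (send e) (recv e))).
Definition D_ll (VG : 'cV[R]_m) : 'M[R]_kll := ulsubmx (Dmx VG).
Definition D_gl (VG : 'cV[R]_m) : 'M[R]_kgl := ulsubmx (drsubmx (Dmx VG)).
Definition D_gg (VG : 'cV[R]_m) : 'M[R]_kgg := drsubmx (drsubmx (Dmx VG)).

Definition Smx (VG : 'cV[R]_m) : 'M[R]_n :=
  4^-1 *: (diag_mx (VLstar VG)^T *m BLL *m diag_mx (VLstar VG)^T).

(* The norm of a matrix is the maximum of the absolute values of its entries,
   and 0 if the matrix is empty. *)
Definition Delta (P : 'cV[R]_(n + m)) (VG : 'cV[R]_m) (QL : 'cV[R]_n) : R :=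
  `| invmx (Smx VG) *m
     (QL - 4 *: (abs_incidence_Lll *m invmx (D_ll VG)
                 *m diag_mx (p_ll P)^T *m p_ll P)) |.

Definition Gamma_ll (P : 'cV[R]_(n + m)) (VG : 'cV[R]_m) : R :=
  `| invmx (D_ll VG) *m p_ll P |.
Definition Gamma_gl (P : 'cV[R]_(n + m)) (VG : 'cV[R]_m) : R :=
  `| invmx (D_gl VG) *m p_gl P |.
Definition Gamma_gg (P : 'cV[R]_(n + m)) (VG : 'cV[R]_m) : R :=
  `| invmx (D_gg VG) *m p_gg P |.

Definition v_plus (P : 'cV[R]_(n + m)) (VG : 'cV[R]_m) (QL : 'cV[R]_n) : R :=
  Num.sqrt (2^-1 * (1 - Delta P VG QL / 2
    + Num.sqrt (1 - (Delta P VG QL + 4 * Gamma_gl P VG ^+ 2)))).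

(* A phase angle in the circle is given by any real representative. *)
Record PF_solution (P : 'cV[R]_(n + m)) (VG : 'cV[R]_m) (QL : 'cV[R]_n)
    (theta : 'cV[R]_(n + m)) (VL : 'cV[R]_n) : Prop := PFSolution {
  PF_VL_gt0 : forall i, 0 < VL i 0;
  PF_active : let V := col_mx VL VG in
    forall i : bus, P i 0 =
      \sum_j V i 0 * V j 0 * Bmx i j * sin (theta i 0 - theta j 0);
  PF_reactive : let V := col_mx VL VG in
    forall i : 'I_n, QL i 0 =
      - \sum_j V (lshift m i) 0 * V j 0 * Bmx (lshift m i) j
               * cos (theta (lshift m i) 0 - theta j 0)
}.

End Network.

Definition negative_definite (R : realType) (n : nat) (M : 'M[R]_n) : Prop :=
  M^T = M /\ forall x : 'cV[R]_n, x != 0 -> (x^T *m M *m x) 0 0 < 0.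

(* The representative of x modulo 2 pi in the interval (-pi, pi]. *)
Definition principal_angle (R : realType) (x : R) : R :=
  x - (Num.ceil ((x - pi) / (2 * pi)))%:~R * (2 * pi).

Lemma principal_angle_itv (R : realType) (x : R) :
  - pi < principal_angle x <= pi.
Proof.
have tp : 0 < 2 * pi :> R by rewrite mulr_gt0 ?pi_gt0.
have /andP[h1 h2] := ceil_itv ((x - pi) / (2 * pi)).
move: h1 h2; rewrite ltr_pdivlMr // ler_pdivrMr // intrB mulrBl mul1r.
by rewrite /principal_angle; set c := _ * _ => h1 h2; apply/andP; split; lra.
Qed.

Definition branch_angle (R : realType) (n m kll kgl kgg : nat)
    (N : network R n m kll kgl kgg) (theta : 'cV[R]_(n + m))
    (e : 'I_(kll + (kgl + kgg))) : R :=
  principal_angle (theta (send N e) 0 - theta (recv N e) 0).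

(* Main.v *)
Require Import Defs.
From mathcomp Require Import all_boot all_order all_algebra.
From mathcomp Require Import ring lra.
From mathcomp Require Import all_classical all_reals all_analysis.
Import Order.TTheory GRing.Theory Num.Theory.
Import numFieldNormedType.Exports.
Local Open Scope ring_scope.

Set Implicit Arguments.
Unset Strict Implicit.

(** Normalise the load voltages as v = V_L / V_L^*, with v = 1 at the generators.
    In a radial network the incidence matrix A has full column rank and P is
    orthogonal to its left kernel, so the flows p = A^+ P determine the sines of
    the branch angles: sin eta_e = p_e / (D_e v_i v_j) for e = (i, j)
    ([incidence_branch_flow], [radial_potential]).  Eliminating the cosines from
    the reactive equations leaves a closed system for v alone,
      v = F v,   F v = 1 + S^-1 w(v) / 4,
      w_i(v) = - Q_i / v_i + sum over e = (i, j) of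
                 D_e v_j (1 - sqrt (1 - (p_e / (D_e v_i v_j))^2)).

    The fixed point comes from order rather than topology.  Each term of w_i is
    nonincreasing in both v_i and v_j ([end_defect_antitone]), and - S is an
    M-matrix, so S^-1 reverses the entrywise order ([inverse_nonneg], [invS_antitone]).  Hence F is
    nondecreasing, and the Knaster-Tarski argument ([box_fixpoint]) gives a fixed
    point in the box [v_+, 1]^n as soon as F 1 <= 1, which is clear from w >= 0,
    and v_+ <= F v_+.

    The last inequality is where the hypotheses enter.  At the constant vector
    s = v_+ the load-load losses are at most 4 p_e^2 / (D_e s), because s > 1/2;
    together with - Q_L / s they contribute at most Delta / (4 s) to 1 - F s.  The
    generator-load terms are at most D_e (1 - cos gamma_gl), and their sum is at
    most - 4 (1 - cos gamma_gl) S 1 because B_LL V_L^* = - B_LG V_G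
    ([generator_share]).  So it suffices that
      s <= sqrt (1 - (Gamma_gl / s)^2) - Delta / (4 s),
    and v_+^2 is the larger root of the quadratic equation obtained from the
    equality case ([voltage_floor]). *)

(** * A fixed point theorem for monotone maps on a box *)

(** The fixed point is the entrywise supremum of the vectors of the box with
    u <= F u, as in the Knaster-Tarski theorem. *)
Lemma box_fixpoint (R : realType) (I : Type) (lo hi : I -> R)
    (F : (I -> R) -> I -> R) :
  (forall i, lo i <= hi i) ->
  (forall u v, (forall i, lo i <= u i) -> (forall i, u i <= v i) ->
     (forall i, v i <= hi i) -> forall i, F u i <= F v i) ->
  (forall i, lo i <= F lo i) -> (forall i, F hi i <= hi i) ->
  exists2 v, (forall i, lo i <= v i <= hi i) & F v = v.
Proof.
move=> lohi Fmono Flo Fhi.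
pose post (u : I -> R) :=
  forall i, [/\ lo i <= u i, u i <= hi i & u i <= F u i].
pose E i : set R := [set x | exists2 u, post u & x = u i]%classic.
have lo_post : post lo by move=> i; split.
have E_ub i : has_ubound (E i).
  by exists (hi i) => _ [u u_post ->]; case: (u_post i).
pose v i := sup (E i).
have le_v u : post u -> forall i, u i <= v i.
  by move=> u_post i; apply: ub_le_sup => //; exists u.
have v_le i x : (forall u, post u -> u i <= x) -> v i <= x.
  move=> ubx; apply: ge_sup; first by exists (lo i), lo.
  by move=> _ [u u_post ->]; apply: ubx.
have lov i : lo i <= v i by exact: le_v.
have vhi i : v i <= hi i by apply: v_le => u /(_ i)[].
have vF i : v i <= F v i.
  apply: v_le => u u_post; have [_ _ /le_trans->//] := u_post i.
  by apply: Fmono => // j; [case: (u_post j) | exact: le_v].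
have Fv_post : post (F v).
  have loF i : lo i <= F v i by exact: le_trans (lov i) (vF i).
  have Fhi' i : F v i <= hi i.
    by apply: le_trans (Fhi i); apply: Fmono.
  by move=> i; split => //; apply: Fmono.
exists v => [i|]; first by rewrite lov vhi.
by apply/funext => i; apply/eqP; rewrite eq_le vF le_v.
Qed.

(** * Trigonometric estimates *)

(** This is 1 - cos (asin x), the relative loss of reactive power on a branch
    whose angle has sine x. *)
Definition cos_defect (R : realType) (x : R) : R := 1 - Num.sqrt (1 - x ^+ 2).

Lemma cos_defect_ge0 (R : realType) (x : R) : 0 <= cos_defect x.
Proof.
by rewrite subr_ge0 -[leRHS]sqrtr1 ler_wsqrtr // gerBl sqr_ge0.
Qed.

Lemma cos_defect_le (R : realType) (x y : R) :
  x ^+ 2 <= y ^+ 2 -> cos_defect x <= cos_defect y.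
Proof. by move=> xy; rewrite lerD2l lerN2 ler_wsqrtr // lerD2l lerN2. Qed.

Lemma cos_defect_le_sqr (R : realType) (x : R) :
  x ^+ 2 <= 1 -> cos_defect x <= x ^+ 2.
Proof.
move=> x1; have x1' : 0 <= 1 - x ^+ 2 by rewrite subr_ge0.
have := sqr_sqrtr x1'; have := sqrtr_ge0 (1 - x ^+ 2).
rewrite /cos_defect; set r := Num.sqrt _ => r0 rr; have := sqr_ge0 x; nra.
Qed.

(** [cos_defect] is convex and vanishes at 0. *)
Lemma cos_defect_scale (R : realType) (t x : R) : 0 <= t <= 1 ->
  x ^+ 2 <= 1 -> cos_defect (t * x) <= t * cos_defect x.
Proof.
move=> /andP[t0 t1] x1; have x1' : 0 <= 1 - x ^+ 2 by rewrite subr_ge0.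
have rr := sqr_sqrtr x1'; have r0 := sqrtr_ge0 (1 - x ^+ 2).
rewrite /cos_defect; set r := Num.sqrt (1 - x ^+ 2) in rr r0 *.
have r1 : r <= 1 by have := sqr_ge0 x; nra.
suff : 1 - t + t * r <= Num.sqrt (1 - (t * x) ^+ 2) by lra.
rewrite -[leLHS]ger0_norm; last by nra.
rewrite -sqrtr_sqr ler_wsqrtr // exprMn.
have -> : x ^+ 2 = 1 - r ^+ 2 by rewrite rr; ring.
have : 0 <= t * (1 - t) * (1 - r) by rewrite !mulr_ge0 ?subr_ge0.
nra.
Qed.

(** Read c as a flow ratio and a, b as the normalised voltages of the two ends of
    a branch: the loss seen from the end a decreases in both voltages.  The
    decrease in b is not visible from the factor b; it holds because raising b
    scales the sine by b / b' or less, and [cos_defect_scale] turns this into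
    the same factor on the defect. *)
Lemma end_defect_antitone (R : realType) (c a b a' b' : R) :
  0 < a -> 0 < b -> a <= a' -> b <= b' -> (c / (a * b)) ^+ 2 <= 1 ->
  b' * cos_defect (c / (a' * b')) <= b * cos_defect (c / (a * b)).
Proof.
move=> a0 b0 aa' bb' c1.
have a'0 : 0 < a' by exact: lt_le_trans aa'.
have b'0 : 0 < b' by exact: lt_le_trans bb'.
have tb : b = b' * (b / b') by rewrite mulrC divfK ?gt_eqF.
rewrite [X in _ <= X * _]tb -mulrA ler_pM2l //.
have t01 : 0 <= b / b' <= 1.
  by rewrite ler_pdivrMr // mul1r bb' divr_ge0 // ltW.
apply: le_trans (cos_defect_scale t01 c1).
apply: cos_defect_le; rewrite -subr_ge0.
have -> : (b / b' * (c / (a * b))) ^+ 2 - (c / (a' * b')) ^+ 2 =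
    (c / (a * a' * b')) ^+ 2 * (a' - a) * (a' + a).
  by field; rewrite !gt_eqF.
apply: mulr_ge0; last by rewrite addr_ge0 ?ltW.
by rewrite mulr_ge0 ?sqr_ge0 ?subr_ge0.
Qed.

Lemma norm_div_le (R : realFieldType) (c g a b : R) :
  `|c| <= g -> 0 < b -> b <= a -> `|c / a| <= g / b.
Proof.
move=> cg b0 ba; have a0 : 0 < a by exact: lt_le_trans ba.
rewrite normrM normfV (gtr0_norm a0) ler_pM ?invr_ge0 ?lef_pV2 ?posrE //.
exact: ltW.
Qed.

Lemma le_asin (R : realType) (y g : R) : - (pi / 2) <= y <= pi / 2 ->
  -1 <= g <= 1 -> sin y <= g -> y <= asin g.
Proof.
move=> y_itv g_itv; apply: contraTT; rewrite -!ltNge => gy.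
rewrite -[g]asinK ?in_itv //= ltr_sin // in_itv //=.
by rewrite asin_geNpi2 ?asin_lepi2.
Qed.

Lemma norm_asin_le (R : realType) (x g : R) : `|x| <= g -> g <= 1 ->
  `|asin x| <= asin g.
Proof.
move=> xg g1; have g0 : 0 <= g := le_trans (normr_ge0 x) xg.
have x_itv : -1 <= x <= 1 by rewrite -ler_norml (le_trans xg).
have /andP[Ngx xg'] : - g <= x <= g by rewrite -ler_norml.
have g_itv : -1 <= g <= 1 by lra.
have a1 := asin_geNpi2 x_itv; have a2 := asin_lepi2 x_itv.
rewrite ler_norml lerNl; apply/andP; split; apply: le_asin => //; last first.
- by rewrite asinK ?in_itv /=.
- by rewrite a1 a2.
- by rewrite sinN asinK ?in_itv //=; lra.
- by rewrite lerN2 a2 lerNl a1.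
Qed.

Lemma asin_lt_pi4 (R : realType) (g : R) : 0 <= g -> 2 * g ^+ 2 < 1 ->
  asin g < pi / 4.
Proof.
move=> g0 g2; have g_itv : -1 <= g <= 1 by nra.
have pi0 := pi_gt0 R.
have h0 : 0 < sin (pi / 4 : R) by apply: sin_gt0_pihalf; lra.
have h2 : 2 * sin (pi / 4 : R) ^+ 2 = 1.
  have := cos_mulr2n (pi / 4 : R).
  have -> : (pi / 4) *+ 2 = pi / 2 :> R by field.
  by rewrite cos_pihalf cos2sin2; lra.
rewrite ltNge; apply/negP => h.
have : sin (pi / 4 : R) <= g.
  rewrite -[g]asinK ?in_itv //=; move: h; rewrite le_eqVlt => /predU1P[->//|h].
  have a2 := asin_lepi2 g_itv.
  by rewrite ltW // ltr_sin // in_itv /=; lra.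
nra.
Qed.

Lemma principal_angle_id (R : realType) (x : R) :
  - pi < x <= pi -> principal_angle x = x.
Proof.
move=> /andP[x1 x2]; have pi0 := pi_gt0 R.
rewrite /principal_angle (_ : Num.ceil _ = 0) ?mul0r ?subr0 //.
apply/eqP; rewrite ceil_eq ltr_pdivlMr ?ler_pdivrMr; [|lra|lra].
by rewrite /=; lra.
Qed.

(** With u = s^2 the last inequality is the equality
    (u + D / 4)^2 = u - G^2, that is u^2 - (1 - D / 2) u + G^2 + D^2 / 16 = 0,
    whose discriminant is 1 - (D + 4 G^2). *)
Lemma voltage_floor (R : realType) (D G : R) : 0 <= D -> D + 4 * G ^+ 2 < 1 ->
  let s := Num.sqrt (2^-1 * (1 - D / 2 + Num.sqrt (1 - (D + 4 * G ^+ 2)))) in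
  [/\ 2^-1 < s, s <= 1, 2 * (G / s) ^+ 2 < 1 &
      s <= 1 - (D / (4 * s) + cos_defect (G / s))].
Proof.
move=> D0 DG s.
have r2 : 0 <= 1 - (D + 4 * G ^+ 2) by lra.
have rr := sqr_sqrtr r2; have r0 := sqrtr_ge0 (1 - (D + 4 * G ^+ 2)).
have G0 := sqr_ge0 G.
have u0 : 0 <= 2^-1 * (1 - D / 2 + Num.sqrt (1 - (D + 4 * G ^+ 2))) by lra.
have ss : s ^+ 2 = _ := sqr_sqrtr u0.
have s0 : 0 <= s := sqrtr_ge0 _.
set r := Num.sqrt (1 - _) in rr r0 ss.
have s12 : 2^-1 < s by nra.
have sp : 0 < s by lra.
have r1 : r <= 1 by nra.
have Gs : (G / s) ^+ 2 * s ^+ 2 = G ^+ 2 by field; rewrite gt_eqF.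
split => //.
- by nra.
- rewrite -subr_gt0 -(pmulr_lgt0 _ (exprn_gt0 2 sp)).
  by rewrite mulrBl mul1r -mulrA Gs; lra.
- rewrite /cos_defect.
  suff -> : Num.sqrt (1 - (G / s) ^+ 2) = s + D / (4 * s) by lra.
  have h0 : 0 <= s + D / (4 * s) by rewrite addr_ge0 // divr_ge0 //; lra.
  rewrite -[RHS]ger0_norm // -sqrtr_sqr; congr Num.sqrt.
  apply: (mulIf (lt0r_neq0 (exprn_gt0 2 sp))); rewrite mulrBl mul1r Gs.
  have -> : (s + D / (4 * s)) ^+ 2 * s ^+ 2 = (s ^+ 2 + D / 4) ^+ 2.
    by field; rewrite gt_eqF.
  by rewrite ss; lra.
Qed.

(** * Matrices with a nonnegative inverse *)

Lemma scale_entry (R : pzRingType) (k : nat) (a : R) (x : 'cV[R]_k) i :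
  (a *: x) i 0 = a * x i 0.
Proof. by rewrite mxE. Qed.

Lemma sub_entry (R : zmodType) (k : nat) (x y : 'cV[R]_k) i :
  (x - y) i 0 = x i 0 - y i 0.
Proof. by rewrite mxE [(- y) i 0]mxE. Qed.

Lemma trivial_kernel_unit (F : fieldType) (n : nat) (M : 'M[F]_n) :
  (forall x : 'cV[F]_n, M *m x = 0 -> x = 0) -> M \in unitmx.
Proof.
move=> ker0; rewrite -unitmx_tr -row_free_unit -kermx_eq0.
apply/rowV0P => u /sub_kermxP uM; apply: trmx_inj; rewrite trmx0; apply: ker0.
by apply: trmx_inj; rewrite trmx_mul trmxK uM trmx0.
Qed.

Lemma negative_definite_unit (R : realType) (n : nat) (B : 'M[R]_n) :
  negative_definite B -> B \in unitmx.
Proof.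
move=> [_ Bneg]; apply: trivial_kernel_unit => x Bx.
apply/eqP; case: (eqVneq x 0) => // /Bneg.
by rewrite -mulmxA Bx mulmx0 mxE ltxx.
Qed.

Lemma invmx_diagE (F : fieldType) (k : nat) (d : 'rV[F]_k) (x : 'cV[F]_k) :
  (forall i, d 0 i != 0) ->
  forall i, (invmx (diag_mx d) *m x) i 0 = x i 0 / d 0 i.
Proof.
move=> d0 i; have dU : diag_mx d \in unitmx.
  by rewrite unitmxE det_diag unitfE; apply/prodf_neq0 => j _; apply: d0.
have : diag_mx d *m (invmx (diag_mx d) *m x) = x by rewrite mulKVmx.
rewrite mul_diag_mx => /matrixP/(_ i 0); rewrite [LHS]mxE => <-.
by rewrite mulrC mulKf.
Qed.

Lemma mx_entry_le_norm (R : realType) (k l : nat) (x : 'M[R]_(k, l)) i j :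
  `|x i j| <= `|x|.
Proof.
rewrite [leRHS]/Num.norm /= mx_normrE.
by apply: (@le_bigmax _ _ _ 0 (fun ij => `|x ij.1 ij.2|) (i, j)).
Qed.

(** A nonnegative off-diagonal part makes - B an M-matrix.  Testing B x <= 0
    against the negative part y of x gives y^T B x <= 0.  On the other hand
    x + y is the positive part of x, whose support is disjoint from that of y, so
    y^T B (x + y) >= 0 involves off-diagonal entries only; hence y^T B y >= 0
    and y = 0. *)
Lemma inverse_nonneg (R : realType) (n : nat) (B : 'M[R]_n) (x : 'cV[R]_n) :
  negative_definite B -> (forall i j, i != j -> 0 <= B i j) ->
  (forall i, (B *m x) i 0 <= 0) -> forall i, 0 <= x i 0.
Proof.
move=> [_ Bneg] Boff Bx.
have [y yE] : exists y : 'cV[R]_n, forall i, y i 0 = Num.max 0 (- x i 0).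
  by exists (\col_i Num.max 0 (- x i 0)) => i; rewrite mxE.
have y0 i : 0 <= y i 0 by rewrite yE le_max lexx.
suff y_eq0 : y = 0.
  move=> i; have := yE i; rewrite y_eq0 mxE.
  by case: (lerP 0 (- x i 0)) => h; lra.
apply/eqP; case: (eqVneq y 0) => // /Bneg.
rewrite ltNge -mulmxA mxE => /negP[].
under eq_bigr do rewrite mxE.
have Bxy i : (B *m (x + y)) i 0 = (B *m x) i 0 + (B *m y) i 0.
  by rewrite mulmxDr mxE.
have : 0 <= \sum_i (y i 0 * (B *m x) i 0 + y i 0 * (B *m y) i 0).
  apply: sumr_ge0 => i _; rewrite -mulrDr -Bxy [(B *m _) i 0]mxE big_distrr /=.
  apply: sumr_ge0 => j _; rewrite [(x + y) j 0]mxE.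
  have z0 : 0 <= x j 0 + y j 0.
    by rewrite yE; case: (lerP 0 (- x j 0)) => h; lra.
  have [<-|ij] := eqVneq i j; last by rewrite !mulr_ge0 ?Boff.
  (* One of the two factors vanishes: they are the two parts of x i. *)
  suff -> : y i 0 * (B i i * (x i 0 + y i 0)) = 0 by [].
  by rewrite yE; case: (lerP 0 (- x i 0)) => h; ring.
rewrite big_split /=.
have : \sum_i y i 0 * (B *m x) i 0 <= 0.
  by apply: sumr_le0 => i _; rewrite mulr_ge0_le0.
by lra.
Qed.

(** * Radial graphs *)

Section Graph.
Variables (R : realType) (n m kll kgl kgg : nat).
Variable N : network R n m kll kgl kgg.
Hypothesis Nax : network_axioms N.

Local Notation bus := 'I_(n + m).
Local Notation branch := 'I_(kll + (kgl + kgg)).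
Local Notation A := (incidence N).
Local Notation snd e := (send N e).
Local Notation rcv e := (recv N e).

Lemma joined_ends (e : branch) : joined N (snd e) (rcv e).
Proof. by apply/existsP; exists e. Qed.

Lemma joinedC : symmetric (joined N).
Proof.
by move=> i j; rewrite /joined; under eq_existsb do rewrite finset.setUC.
Qed.

Lemma ends_eq (e : branch) (i j : bus) : (ends N e == [set i; j]) =
  ((i == snd e) && (j == rcv e)) || ((i == rcv e) && (j == snd e)).
Proof.
apply/eqP/orP => [E|]; last first.
  by case=> /andP[/eqP-> /eqP->] //; rewrite /ends finset.setUC.
have : rcv e \in [set i; j] by rewrite -E set22.
have : snd e \in [set i; j] by rewrite -E set21.
have : j \in ends N e by rewrite E set22.
have : i \in ends N e by rewrite E set21.
have /negPf sr := no_loop Nax e.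
have /negPf rs : rcv e != snd e by rewrite eq_sym sr.
by rewrite !inE => /orP[] /eqP-> /orP[] /eqP->; rewrite ?eqxx ?sr ?rs //=; tauto.
Qed.

Lemma joined_neq (i j : bus) : joined N i j -> i != j.
Proof.
case/existsP => e; rewrite ends_eq => /orP[] /andP[/eqP-> /eqP->].
  exact: no_loop.
by rewrite eq_sym; apply: no_loop.
Qed.

(** A sum over the neighbours of a bus is a sum over the branches at that bus,
    since in a simple graph every neighbour is reached by exactly one branch. *)
Lemma sum_neighbours (i : bus) (f : bus -> R) :
  (forall j, ~~ joined N i j -> f j = 0) ->
  \sum_j f j =
    \sum_e ((i == snd e)%:R * f (rcv e) + (i == rcv e)%:R * f (snd e)).
Proof.
move=> f0.
have -> : \sum_j f j = \sum_j \sum_e (ends N e == [set i; j])%:R * f j.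
  apply: eq_bigr => j _; have [/existsP[e ije]|/f0 ->] := boolP (joined N i j).
    rewrite (bigD1 e) //= ije mul1r big1 ?addr0 // => e' e'e.
    case: eqP => [e'ij|]; rewrite ?mul0r //.
    by case/eqP: e'e; apply: (no_parallel Nax); rewrite e'ij (eqP ije).
  by rewrite big1 // => e _; rewrite mulr0.
rewrite exchange_big; apply: eq_bigr => e _.
under eq_bigr do rewrite ends_eq.
have sr := no_loop Nax e.
have [->|_] := eqVneq i (snd e).
  rewrite (negPf sr) /= mul1r mul0r addr0 (bigD1 (rcv e)) //= eqxx mul1r.
  by rewrite big1 ?addr0 // => j /negPf->; rewrite mul0r.
have [_|_] := eqVneq i (rcv e); last first.
  by rewrite /= !mul0r addr0 big1 // => j _; rewrite mul0r.
rewrite /= mul1r mul0r add0r (bigD1 (snd e)) //= eqxx mul1r.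
by rewrite big1 ?addr0 // => j /negPf->; rewrite mul0r.
Qed.

Lemma incidenceE (x : 'cV[R]_(kll + (kgl + kgg))) (i : bus) :
  (A *m x) i 0 = \sum_e ((i == snd e)%:R - (i == rcv e)%:R) * x e 0.
Proof. by rewrite mxE; apply: eq_bigr => e _; rewrite mxE. Qed.

Lemma potential_difference (theta : 'cV[R]_(n + m)) (e : branch) :
  (A^T *m theta) e 0 = theta (snd e) 0 - theta (rcv e) 0.
Proof.
rewrite mxE.
under eq_bigr do rewrite !mxE mulrBl !mulr_natl !mulrb.
by rewrite sumrB -!big_mkcond /= !big_pred1_eq.
Qed.

Lemma abs_incidenceE (i : bus) (e : branch) :
  abs_incidence N i e = (i == snd e)%:R + (i == rcv e)%:R.
Proof.
rewrite !mxE; have [->|_] := eqVneq i (snd e).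
  by rewrite (negPf (no_loop Nax e)) subr0 addr0 normr1.
by rewrite sub0r add0r normrN normr_nat.
Qed.

Hypothesis Nrad : radial N.

(** Removing e from a forest separates its ends; the indicator of the component
    of the sending end is then constant along every branch but e. *)
Lemma radial_cut (e : branch) : exists theta : 'cV[R]_(n + m),
  A^T *m theta = delta_mx e 0.
Proof.
pose cut : rel bus := fun i j => joined N i j && ([set i; j] != ends N e).
have cutC : connect_sym cut.
  by apply: sym_connect_sym => i j; rewrite /cut joinedC finset.setUC.
have cut_rcv : ~~ connect cut (snd e) (rcv e).
  (* Closing a simple path that avoids e by e itself gives a cycle, so the path
     has one edge, which can only be e. *)
  apply/negP => /connectP[p p_path]; case/shortenP: p_path => {}p p_path p_uniq _.
  move=> p_last; have cyc : ucycle (joined N) (snd e :: p).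
    rewrite /ucycle p_uniq andbT /= rcons_path -p_last joinedC joined_ends andbT.
    by apply: sub_path p_path => i j /andP[].
  have := Nrad cyc; case: p p_path p_last {p_uniq cyc} => [_ sr _|x [|//]] /=.
    by case/eqP: (no_loop Nax e).
  by move=> /andP[/andP[_ /eqP]] h _ xr; case: h; rewrite /ends xr.
exists (\col_i (connect cut (snd e) i)%:R); apply/matrixP => f z.
rewrite ord1 potential_difference !mxE eqxx andbT.
have [->|fe] := eqVneq f e; first by rewrite connect0 (negPf cut_rcv) subr0.
suff -> : connect cut (snd e) (snd f) = connect cut (snd e) (rcv f).
  by rewrite subrr.
rewrite !(cutC (snd e)); apply: same_connect => //; apply: connect1.
rewrite /cut joined_ends /=; apply: contra fe => /eqP fe.
by apply/eqP; apply: (no_parallel Nax).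
Qed.

(** Pairing A x with the cut potential of e returns the entry x e. *)
Lemma incidence_inj (x : 'cV[R]_(kll + (kgl + kgg))) : A *m x = 0 -> x = 0.
Proof.
move=> Ax; apply/matrixP => e z; rewrite ord1 mxE.
have [theta thetaE] := radial_cut e.
have : theta^T *m (A *m x) = 0 by rewrite Ax mulmx0.
rewrite mulmxA -[theta^T *m A]trmxK trmx_mul trmxK thetaE.
by rewrite trmx_delta -rowE => /rowP/(_ 0); rewrite !mxE.
Qed.

Lemma normal_unit : A^T *m A \in unitmx.
Proof.
apply: trivial_kernel_unit => u uK.
suff : A *m u = 0 by exact: incidence_inj.
apply/matrixP => i z; rewrite ord1 [RHS]mxE.
have : \sum_j ((A *m u) j 0) ^+ 2 = 0.
  transitivity ((u^T *m (A^T *m A *m u)) 0 0); last by rewrite uK mulmx0 mxE.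
  rewrite -(mulmxA A^T) (mulmxA u^T) -trmx_mul [RHS]mxE.
  by apply: eq_bigr => j _; rewrite expr2; congr (_ * _); rewrite [RHS]mxE.
move/psumr_eq0P => /(_ (fun j _ => sqr_ge0 _) i isT)/eqP.
by rewrite sqrf_eq0 => /eqP.
Qed.

(** Branch angles can be prescribed freely in a radial network: A^T is onto, with
    right inverse A (A^T A)^-1. *)
Lemma radial_potential (eta : 'cV[R]_(kll + (kgl + kgg))) :
  exists theta : 'cV[R]_(n + m),
    forall e, theta (snd e) 0 - theta (rcv e) 0 = eta e 0.
Proof.
exists (A *m (invmx (A^T *m A) *m eta)) => e.
by rewrite -potential_difference mulmxA mulKVmx ?normal_unit.
Qed.

(** The residual P - A p is killed by A^T, so it is constant on the connected
    graph; its entries sum to 0, because those of P do and the columns of A sum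
    to 0. *)
Lemma incidence_branch_flow (P : 'cV[R]_(n + m)) :
  \sum_i P i 0 = 0 -> A *m branch_flow N P = P.
Proof.
move=> Psum; pose y := P - A *m branch_flow N P.
have Ay : A^T *m y = 0.
  rewrite mulmxBr /branch_flow -(mulmxA (invmx _)) (mulmxA A^T A).
  by rewrite mulKVmx ?normal_unit ?subrr.
have y_joined i j : joined N i j -> y i 0 = y j 0.
  have ye e : y (snd e) 0 = y (rcv e) 0.
    by apply/eqP; rewrite -subr_eq0 -potential_difference Ay mxE.
  case/existsP => e; rewrite ends_eq => /orP[] /andP[/eqP-> /eqP->].
    exact: ye.
  by rewrite ye.
have y_const i j : y i 0 = y j 0.
  case/connectP: (graph_connected Nax i j) => p + ->.
  by elim: p i => //= k p IH i /andP[/y_joined-> /IH].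
have ysum : \sum_i y i 0 = 0.
  have one (k : bus) : \sum_i (i == k)%:R = 1 :> R.
    by rewrite (bigD1 k) //= eqxx big1 ?addr0 // => i /negPf->.
  have -> : \sum_i y i 0 = \sum_i P i 0 - \sum_i (A *m branch_flow N P) i 0.
    by rewrite -sumrB; apply: eq_bigr => i _; rewrite sub_entry.
  rewrite Psum sub0r; under eq_bigr do rewrite incidenceE.
  rewrite exchange_big big1 ?oppr0 //= => e _; rewrite -big_distrl sumrB /=.
  by rewrite !one subrr mul0r.
apply/eqP; rewrite eq_sym -subr_eq0 -/y; apply/eqP/matrixP => i z.
rewrite ord1 [RHS]mxE; move: ysum; under eq_bigr do rewrite (y_const _ i).
rewrite sumr_const card_ord => /eqP; rewrite mulrn_eq0 => /orP[/eqP nm0|/eqP //].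
by have := ltn_ord i; rewrite [X in (_ < X)%N]nm0.
Qed.

End Graph.

(** * The stiffness matrices *)

Section Stiffness.
Variables (R : realType) (n m kll kgl kgg : nat).
Variable N : network R n m kll kgl kgg.
Hypothesis Nax : network_axioms N.
Hypothesis BLL_neg : negative_definite (BLL N).
Variable VG : 'cV[R]_m.
Hypothesis VG_gt0 : forall g, 0 < VG g 0.
Hypothesis m_gt0 : (0 < m)%N.

Local Notation bus := 'I_(n + m).
Local Notation branch := 'I_(kll + (kgl + kgg)).
Local Notation B := (Bmx N).
Local Notation U := (Vstar N VG).
Local Notation S := (Smx N VG).

Lemma Bmx_unjoined (i j : bus) : i != j -> ~~ joined N i j -> B i j = 0.
Proof. by move=> /negPf ij nij; rewrite mxE ij (susceptance_eq0 Nax) ?oppr0. Qed.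

Lemma Bmx_joined (i j : bus) : joined N i j -> 0 < B i j.
Proof.
move=> ij; have /negPf nij := joined_neq Nax ij.
by rewrite mxE nij oppr_gt0 (susceptance_lt0 Nax).
Qed.

Lemma Bmx_ge0 (i j : bus) : i != j -> 0 <= B i j.
Proof.
move=> ij; have [/Bmx_joined/ltW//|nij] := boolP (joined N i j).
by rewrite Bmx_unjoined.
Qed.

Lemma Bmx_sym (i j : bus) : B i j = B j i.
Proof.
rewrite !mxE [j == i]eq_sym; case: eqVneq => [->//|_].
by rewrite (susceptance_sym Nax).
Qed.

Lemma BmxLL (i j : 'I_n) : BLL N i j = B (lshift m i) (lshift m j).
Proof. by rewrite !mxE. Qed.

Lemma BmxLG (i : 'I_n) (g : 'I_m) : BLG N i g = B (lshift m i) (rshift n g).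
Proof. by rewrite !mxE. Qed.

Lemma BLL_ge0 (i j : 'I_n) : i != j -> 0 <= BLL N i j.
Proof.
by move=> ij; rewrite BmxLL Bmx_ge0 //; apply: contra ij => /eqP/lshift_inj->.
Qed.

Lemma VstarL (i : 'I_n) : U (lshift m i) 0 = VLstar N VG i 0.
Proof. exact: col_mxEu. Qed.

Lemma VstarG (g : 'I_m) : U (rshift n g) 0 = VG g 0.
Proof. exact: col_mxEd. Qed.

Lemma load_row (x : 'cV[R]_n) (y : 'cV[R]_m) (i : 'I_n) :
  \sum_j B (lshift m i) j * col_mx x y j 0 =
    (BLL N *m x) i 0 + (BLG N *m y) i 0.
Proof.
rewrite big_split_ord /= !mxE; congr (_ + _); apply: eq_bigr => j _.
  by rewrite col_mxEu BmxLL.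
by rewrite col_mxEd BmxLG.
Qed.

Lemma BLL_VLstar : BLL N *m VLstar N VG = - (BLG N *m VG).
Proof.
by rewrite /VLstar mulmxN -(mulmxA (invmx _)) mulKVmx // negative_definite_unit.
Qed.

Lemma VLstar_ge0 (i : 'I_n) : 0 <= VLstar N VG i 0.
Proof.
apply: (inverse_nonneg BLL_neg BLL_ge0) => k; rewrite BLL_VLstar !mxE.
rewrite oppr_le0 sumr_ge0 // => g _; rewrite BmxLG.
by rewrite mulr_ge0 ?Bmx_ge0 ?eq_lrshift // ltW.
Qed.

(** Row i of B_LL V_L^* + B_LG V_G = 0 shows that the zero set of V^* >= 0 is
    closed under adjacency: if V_i^* = 0, then the row is a vanishing sum of
    nonnegative terms B_ij V_j^*.  By connectedness this set would contain a
    generator. *)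
Lemma Vstar_gt0 (i : bus) : 0 < U i 0.
Proof.
have U0 j : 0 <= U j 0.
  by case: (split_ordP j) => k ->; rewrite ?VstarL ?VstarG ?VLstar_ge0 // ltW.
rewrite lt_neqAle eq_sym U0 andbT; apply/negP => /eqP Ui.
have spread j k : joined N j k -> U j 0 = 0 -> U k 0 = 0.
  case: (split_ordP j) => l -> jk; last by rewrite VstarG => /eqP; rewrite gt_eqF.
  move=> Ul; have := load_row (VLstar N VG) VG l.
  rewrite BLL_VLstar mxE addNr => /psumr_eq0P H.
  suff /(_ k isT)/eqP : forall k0, true -> B (lshift m l) k0 * U k0 0 = 0.
    by rewrite mulf_eq0 gt_eqF ?Bmx_joined // => /eqP.
  apply: H => k' _; have [<-|?] := eqVneq (lshift m l) k'.
    by rewrite -/(Vstar N VG) Ul mulr0.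
  by rewrite mulr_ge0 ?Bmx_ge0 ?U0.
have /connectP[p] := graph_connected Nax i (rshift n (Ordinal m_gt0)).
elim: p i Ui => [|k p IH] i Ui /=; last by case/andP => /spread/(_ Ui); apply: IH.
by move=> _ iE; move: Ui; rewrite -iE VstarG => /eqP; rewrite gt_eqF.
Qed.

Lemma SmxE (x : 'cV[R]_n) (i : 'I_n) : (S *m x) i 0 =
  4^-1 * (VLstar N VG i 0 * (BLL N *m \col_j (VLstar N VG j 0 * x j 0)) i 0).
Proof.
rewrite /Smx -scalemxAl mxE -!mulmxA mul_diag_mx mxE; congr (_ * (_ * _)).
  by rewrite mxE.
by congr ((_ *m _) _ _); rewrite mul_diag_mx; apply/matrixP => j z; rewrite !mxE ord1.
Qed.

Lemma Smx_negative : negative_definite S.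
Proof.
have [BT Bneg] := BLL_neg; split.
  by rewrite /Smx linearZ /= !trmx_mul tr_diag_mx BT mulmxA.
move=> x x0; pose y := diag_mx (VLstar N VG)^T *m x.
have -> : x^T *m S *m x = 4^-1 *: (y^T *m BLL N *m y).
  by rewrite /Smx /y trmx_mul tr_diag_mx -scalemxAr -scalemxAl !mulmxA.
rewrite mxE pmulr_rlt0 ?invr_gt0 //; apply: Bneg; apply: contra x0 => /eqP y0.
apply/eqP/matrixP => i z; rewrite ord1 [RHS]mxE; apply/eqP.
have := congr1 (fun u : 'cV[R]_n => u i 0) y0.
rewrite /y mul_diag_mx mxE [X in X * _]mxE [RHS]mxE => /eqP.
by rewrite mulf_eq0 -VstarL gt_eqF ?Vstar_gt0.
Qed.

Lemma Smx_ge0 (i j : 'I_n) : i != j -> 0 <= S i j.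
Proof.
move=> ij.
have -> : S i j = 4^-1 * (VLstar N VG i 0 * BLL N i j * VLstar N VG j 0).
  by rewrite /Smx mul_diag_mx mul_mx_diag !mxE.
by rewrite !mulr_ge0 ?invr_ge0 ?VLstar_ge0 ?BLL_ge0.
Qed.

Lemma invS_antitone (a b : 'cV[R]_n) : (forall i, a i 0 <= b i 0) ->
  forall i, (invmx S *m b) i 0 <= (invmx S *m a) i 0.
Proof.
move=> ab i; have SU := negative_definite_unit Smx_negative.
have := @inverse_nonneg _ _ _ (invmx S *m (a - b)) Smx_negative Smx_ge0.
rewrite mulKVmx // => /(_ _ i) H; have := H.
rewrite mulmxBr sub_entry subr_ge0; apply => k.
by rewrite sub_entry subr_le0.
Qed.

End Stiffness.

Lemma split_lshift (k l : nat) (i : 'I_k) : fintype.split (lshift l i) = inl i.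
Proof. exact: (unsplitK (inl i)). Qed.

Lemma split_rshift (k l : nat) (i : 'I_l) : fintype.split (rshift k i) = inr i.
Proof. exact: (unsplitK (inr i)). Qed.

(** * The fixed point equation for the load voltages *)

Section FixedPoint.
Variables (R : realType) (n m kll kgl kgg : nat).
Variable N : network R n m kll kgl kgg.
Hypothesis Nax : network_axioms N.
Hypothesis BLL_neg : negative_definite (BLL N).
Variables (P : 'cV[R]_(n + m)) (VG : 'cV[R]_m) (QL : 'cV[R]_n).
Hypothesis VG_gt0 : forall g, 0 < VG g 0.
Hypothesis m_gt0 : (0 < m)%N.
Hypothesis QL_le0 : forall i, QL i 0 <= 0.
Hypothesis h_gl : Delta N P VG QL + 4 * Gamma_gl N P VG ^+ 2 < 1.
Hypothesis h_ll : Gamma_ll N P VG < 4^-1.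
Hypothesis h_gg : Gamma_gg N P VG < 1.

Local Notation bus := 'I_(n + m).
Local Notation branch := 'I_(kll + (kgl + kgg)).
Local Notation B := (Bmx N).
Local Notation U := (Vstar N VG).
Local Notation S := (Smx N VG).
Local Notation snd e := (send N e).
Local Notation rcv e := (recv N e).
Local Notation vp := (v_plus N P VG QL).
Local Notation Gll := (Gamma_ll N P VG).
Local Notation Ggl := (Gamma_gl N P VG).
Local Notation Ggg := (Gamma_gg N P VG).
Local Notation ll := (ll_idx kgl kgg).
Local Notation gl := (gl_idx kll kgg).
Local Notation gg := (gg_idx kll kgl).

Let U_gt0 := Vstar_gt0 Nax BLL_neg VG_gt0 m_gt0.

Lemma vp_bounds : [/\ 2^-1 < vp, vp <= 1, 2 * (Ggl / vp) ^+ 2 < 1 &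
  vp <= 1 - (Delta N P VG QL / (4 * vp) + cos_defect (Ggl / vp))].
Proof. by apply: voltage_floor h_gl; apply: normr_ge0. Qed.

Let vp_gt0 : 0 < vp.
Proof. by have [h _ _ _] := vp_bounds; lra. Qed.

Lemma send_ll e : snd (ll e) = lshift m (branch_ll N e).1.
Proof. by rewrite /send /ll_idx split_lshift. Qed.
Lemma recv_ll e : rcv (ll e) = lshift m (branch_ll N e).2.
Proof. by rewrite /recv /ll_idx split_lshift. Qed.
Lemma send_gl e : snd (gl e) = rshift n (branch_gl N e).1.
Proof. by rewrite /send /gl_idx split_rshift split_lshift. Qed.
Lemma recv_gl e : rcv (gl e) = lshift m (branch_gl N e).2.
Proof. by rewrite /recv /gl_idx split_rshift split_lshift. Qed.
Lemma send_gg e : snd (gg e) = rshift n (branch_gg N e).1.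
Proof. by rewrite /send /gg_idx !split_rshift. Qed.
Lemma recv_gg e : rcv (gg e) = rshift n (branch_gg N e).2.
Proof. by rewrite /recv /gg_idx !split_rshift. Qed.

Definition stiffness (e : branch) : R :=
  U (snd e) 0 * U (rcv e) 0 * B (snd e) (rcv e).

Lemma stiffness_gt0 e : 0 < stiffness e.
Proof. by rewrite !mulr_gt0 ?U_gt0 // Bmx_joined // joined_ends. Qed.

Definition flow_ratio (e : branch) : R := branch_flow N P e 0 / stiffness e.

Lemma D_llE : D_ll N VG = diag_mx (\row_e stiffness (ll e)).
Proof. by apply/matrixP => i j; rewrite /stiffness !mxE eq_lshift. Qed.

Lemma D_glE : D_gl N VG = diag_mx (\row_e stiffness (gl e)).
Proof. by apply/matrixP => i j; rewrite /stiffness !mxE eq_rshift eq_lshift. Qed.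

Lemma D_ggE : D_gg N VG = diag_mx (\row_e stiffness (gg e)).
Proof. by apply/matrixP => i j; rewrite /stiffness !mxE !eq_rshift. Qed.

Lemma p_llE e : p_ll N P e 0 = branch_flow N P (ll e) 0.
Proof. by rewrite !mxE. Qed.

Lemma flow_ratio_ll e : `|flow_ratio (ll e)| <= Gll.
Proof.
apply: le_trans (mx_entry_le_norm _ e 0).
rewrite D_llE invmx_diagE => [|k].
  by rewrite [X in _ <= `|_ / X|]mxE p_llE.
by rewrite mxE gt_eqF ?stiffness_gt0.
Qed.

Lemma p_glE e : p_gl N P e 0 = branch_flow N P (gl e) 0.
Proof. by rewrite !mxE. Qed.

Lemma flow_ratio_gl e : `|flow_ratio (gl e)| <= Ggl.
Proof.
apply: le_trans (mx_entry_le_norm _ e 0).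
rewrite D_glE invmx_diagE => [|k].
  by rewrite [X in _ <= `|_ / X|]mxE p_glE.
by rewrite mxE gt_eqF ?stiffness_gt0.
Qed.

Lemma p_ggE e : p_gg N P e 0 = branch_flow N P (gg e) 0.
Proof. by rewrite !mxE. Qed.

Lemma flow_ratio_gg e : `|flow_ratio (gg e)| <= Ggg.
Proof.
apply: le_trans (mx_entry_le_norm _ e 0).
rewrite D_ggE invmx_diagE => [|k].
  by rewrite [X in _ <= `|_ / X|]mxE p_ggE.
by rewrite mxE gt_eqF ?stiffness_gt0.
Qed.

(** Generator voltages are fixed, so their normalised value is 1. *)
Definition with_generators (v : 'I_n -> R) (i : bus) : R :=
  col_mx (\col_k v k) (const_mx 1) i 0.
Local Notation ext := with_generators.

Lemma extL v k : ext v (lshift m k) = v k.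
Proof. by rewrite /ext col_mxEu mxE. Qed.

Lemma extG v g : ext v (rshift n g) = 1.
Proof. by rewrite /ext col_mxEd mxE. Qed.

Lemma ext_ge v i : (forall k, vp <= v k) -> vp <= ext v i.
Proof.
move=> v_ge; have [_ vp1 _ _] := vp_bounds.
by case: (split_ordP i) => k ->; rewrite ?extL ?extG.
Qed.

Lemma ext_le u v i : (forall k, u k <= v k) -> ext u i <= ext v i.
Proof.
by move=> uv; case: (split_ordP i) => k ->; rewrite ?extL ?extG.
Qed.

(** The sine of the angle of e that carries the prescribed flow at the
    normalised load voltages v. *)
Definition branch_sine (v : 'I_n -> R) (e : branch) : R :=
  flow_ratio e / (ext v (snd e) * ext v (rcv e)).

Lemma branch_sine_ll v e : (forall k, vp <= v k) ->
  `|branch_sine v (ll e)| <= Gll / vp ^+ 2.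
Proof.
move=> v_ge; apply: norm_div_le; rewrite ?flow_ratio_ll ?exprn_gt0 //.
by rewrite expr2 ler_pM ?ext_ge // ltW.
Qed.

Lemma branch_sine_gl v e : (forall k, vp <= v k) ->
  `|branch_sine v (gl e)| <= Ggl / vp.
Proof.
move=> v_ge; apply: norm_div_le; rewrite ?flow_ratio_gl //.
by rewrite send_gl extG mul1r ext_ge.
Qed.

Lemma branch_sine_gg v e : `|branch_sine v (gg e)| <= Ggg.
Proof.
rewrite /branch_sine send_gg recv_gg !extG mulr1 divr1.
exact: flow_ratio_gg.
Qed.

Lemma sine_bounds : [/\ 0 <= Gll / vp ^+ 2 < 1, 0 <= Ggl / vp < 1 & 0 <= Ggg < 1].
Proof.
have [vp2 _ hgl _] := vp_bounds; split.
- rewrite divr_ge0 ?normr_ge0 ?sqr_ge0 //= ltr_pdivrMr ?exprn_gt0 // mul1r.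
  by apply: lt_trans h_ll _; nra.
- have h : 0 <= Ggl / vp by rewrite divr_ge0 ?normr_ge0 // ltW.
  by rewrite h /=; nra.
- by rewrite normr_ge0 h_gg.
Qed.

Lemma branch_sine_lt1 v e : (forall k, vp <= v k) -> `|branch_sine v e| < 1.
Proof.
move=> v_ge; have [/andP[_ h1] /andP[_ h2] /andP[_ h3]] := sine_bounds.
case: (split_ordP e) => [k ->|k ->].
  by apply: le_lt_trans h1; apply: branch_sine_ll.
case: (split_ordP k) => [l ->|l ->].
  by apply: le_lt_trans h2; apply: branch_sine_gl.
by apply: le_lt_trans h3; apply: branch_sine_gg.
Qed.

Lemma branch_sine_sqr v e : (forall k, vp <= v k) -> branch_sine v e ^+ 2 <= 1.
Proof.
move=> v_ge; rewrite -real_normK ?num_real //.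
by rewrite expr_le1 // ltW // branch_sine_lt1.
Qed.

(** Reactive power withdrawn at load k and lost on its branches, divided by v k:
    the vector w of the fixed point equation. *)
Definition load_loss (v : 'I_n -> R) : 'cV[R]_n := \col_k
  (- QL k 0 / v k + \sum_e stiffness e *
     (((lshift m k == snd e)%:R * ext v (rcv e)
        + (lshift m k == rcv e)%:R * ext v (snd e))
      * cos_defect (branch_sine v e))).

Lemma load_loss_ge0 v : (forall k, vp <= v k) -> forall k, 0 <= load_loss v k 0.
Proof.
move=> v_ge k; rewrite mxE addr_ge0 //.
  by rewrite divr_ge0 ?oppr_ge0 // (le_trans (ltW vp_gt0)).
have ext0 i : 0 <= ext v i by exact: le_trans (ltW vp_gt0) (ext_ge _ v_ge).
apply: sumr_ge0 => e _; rewrite mulr_ge0 ?(ltW (stiffness_gt0 _)) //.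
by rewrite mulr_ge0 ?cos_defect_ge0 // addr_ge0 // mulr_ge0 ?ler0n.
Qed.

Lemma load_loss_antitone u v : (forall k, vp <= u k) -> (forall k, u k <= v k) ->
  forall k, load_loss v k 0 <= load_loss u k 0.
Proof.
move=> u_ge uv k.
have u0 i : 0 < ext u i by exact: lt_le_trans vp_gt0 (ext_ge _ u_ge).
have uvE i := ext_le i uv.
have := u0 (lshift m k); have := uvE (lshift m k); rewrite !extL => uvk uk0.
rewrite !mxE lerD //.
  rewrite ler_wpM2l ?oppr_ge0 // lef_pV2 ?posrE //.
  exact: lt_le_trans uvk.
apply: ler_sum => e _; rewrite ler_pM2l ?stiffness_gt0 //.
rewrite !mulrDl -!mulrA lerD // ler_wpM2l ?ler0n //.
  by apply: end_defect_antitone => //; apply: branch_sine_sqr.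
rewrite /branch_sine (mulrC (ext u (snd e)) (ext u _)).
rewrite (mulrC (ext v (snd e)) (ext v _)).
apply: end_defect_antitone => //; rewrite (mulrC (ext u (rcv e))).
exact: branch_sine_sqr.
Qed.

Local Notation ones := (const_mx 1 : 'cV[R]_n).

(** - 4 S 1 collects at each load the stiffness of its generator branches, since
    B_LL V_L^* = - B_LG V_G. *)
Lemma generator_share (k : 'I_n) : (S *m ones) k 0 =
  - (4^-1 * \sum_(e < kgl) (lshift m k == rcv (gl e))%:R * stiffness (gl e)).
Proof.
rewrite SmxE.
have -> : \col_j (VLstar N VG j 0 * ones j 0) = VLstar N VG.
  by apply/matrixP => j z; rewrite ord1 mxE [const_mx _ _ _]mxE mulr1.
have -> : (BLL N *m VLstar N VG) k 0 = - (BLG N *m VG) k 0.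
  by rewrite BLL_VLstar // [LHS]mxE.
rewrite !mulrN; congr (- (_ * _)).
pose f (j : bus) := (n <= j)%:R * (U (lshift m k) 0 * U j 0 * B (lshift m k) j).
have fL (j : 'I_n) : f (lshift m j) = 0 by rewrite /f /= leqNgt ltn_ord mul0r.
have fG (g : 'I_m) :
    f (rshift n g) = U (lshift m k) 0 * U (rshift n g) 0
      * B (lshift m k) (rshift n g).
  by rewrite /f /= leq_addr mul1r.
transitivity (\sum_j f j).
  rewrite big_split_ord /= big1 ?add0r; last by move=> j _; apply: fL.
  rewrite [(BLG N *m VG) k 0]mxE big_distrr /=; apply: eq_bigr => g _.
  by rewrite fG VstarL VstarG -BmxLG; ring.
rewrite (sum_neighbours Nax (i := lshift m k) (f := f)); last first.
  move=> j; case: (split_ordP j) => l -> nj; first exact: fL.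
  by rewrite fG Bmx_unjoined ?mulr0 // eq_lrshift.
rewrite !big_split_ord /= [X in X + _]big1; last first.
  by move=> e _; rewrite send_ll recv_ll !fL !mulr0 addr0.
rewrite [X in _ + (_ + X)]big1; last first.
  by move=> e _; rewrite send_gg recv_gg !eq_lrshift !mul0r addr0.
rewrite add0r addr0; apply: eq_bigr => e _.
rewrite send_gl eq_lrshift mul0r add0r fG recv_gl.
have [kE|_] := eqVneq (lshift m k) _; last by rewrite !mul0r.
rewrite !mul1r /stiffness send_gl recv_gl -kE Bmx_sym //.
by rewrite (mulrC (U (lshift m k) 0)).
Qed.

(** The vector inside the norm that defines Delta, before S^-1 is applied. *)
Definition effective_load : 'cV[R]_n :=
  QL - 4 *: (abs_incidence_Lll N *m invmx (D_ll N VG)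
             *m diag_mx (p_ll N P)^T *m p_ll N P).

Lemma effective_loadE (k : 'I_n) : effective_load k 0 =
  QL k 0 - 4 * \sum_(e < kll) ((lshift m k == snd (ll e))%:R
     + (lshift m k == rcv (ll e))%:R) * (stiffness (ll e) * flow_ratio (ll e) ^+ 2).
Proof.
rewrite sub_entry scale_entry; congr (_ - _ * _).
rewrite -!mulmxA mxE; apply: eq_bigr => e _.
have -> : abs_incidence_Lll N k e = abs_incidence N (lshift m k) (ll e).
  by rewrite !mxE.
rewrite abs_incidenceE //; congr (_ * _).
rewrite D_llE invmx_diagE; last by move=> i; rewrite mxE gt_eqF ?stiffness_gt0.
rewrite mul_diag_mx [X in X / _]mxE [_^T 0 e]mxE p_llE [X in _ / X]mxE.
by rewrite /flow_ratio; field; rewrite gt_eqF ?stiffness_gt0.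
Qed.

Lemma DeltaE : Delta N P VG QL = `|invmx S *m effective_load|.
Proof. by []. Qed.

(** On load-load branches the defect is at most the squared sine c^2 / vp^4, and
    vp^2 > 1/4 turns the resulting loss c^2 / vp^3 into 4 c^2 / vp, which is
    1 / vp times the share of the branch in the effective load.  On generator-load branches the
    sine is at most Gamma_gl / vp, and [generator_share] sums the losses. *)
Lemma load_loss_floor (k : 'I_n) : load_loss (fun _ => vp) k 0 <=
  (- vp^-1 *: effective_load
     - (4 * cos_defect (Ggl / vp)) *: (S *m ones)) k 0.
Proof.
have [vp2 vp1 _ _] := vp_bounds.
rewrite sub_entry !scale_entry generator_share effective_loadE mxE.
rewrite !big_split_ord /= [X in _ + (_ + X)]big1; last first.
  by move=> e _; rewrite send_gg recv_gg !eq_lrshift !mul0r addr0 mul0r mulr0.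
rewrite addr0.
have -> : - vp^-1 * (QL k 0 - 4 * \sum_(e < kll) ((lshift m k == snd (ll e))%:R
     + (lshift m k == rcv (ll e))%:R) * (stiffness (ll e) * flow_ratio (ll e) ^+ 2)) -
    4 * cos_defect (Ggl / vp) *
    - (4^-1 * (\sum_(e < kgl) (lshift m k == rcv (gl e))%:R
                * stiffness (gl e))) =
  - QL k 0 / vp + ((\sum_(e < kll) 4 / vp * (((lshift m k == snd (ll e))%:R
     + (lshift m k == rcv (ll e))%:R) * (stiffness (ll e) * flow_ratio (ll e) ^+ 2)))
   + \sum_(e < kgl) cos_defect (Ggl / vp) *
        ((lshift m k == rcv (gl e))%:R * stiffness (gl e))).
  by rewrite -!big_distrr /=; field; rewrite gt_eqF.
rewrite lerD2l lerD //; apply: ler_sum => e _.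
- rewrite /branch_sine send_ll recv_ll !extL -mulrDl.
  set a := _%:R + _%:R.
  have a0 : 0 <= a by rewrite addr_ge0.
  have -> : stiffness (ll e) * (a * vp * cos_defect (flow_ratio (ll e) / (vp * vp)))
    = (a * stiffness (ll e)) * (vp * cos_defect (flow_ratio (ll e) / (vp * vp))).
    by ring.
  have -> : 4 / vp * (a * (stiffness (ll e) * flow_ratio (ll e) ^+ 2)) =
    (a * stiffness (ll e)) * (4 / vp * flow_ratio (ll e) ^+ 2) by ring.
  apply: ler_wpM2l; first exact: mulr_ge0 a0 (ltW (stiffness_gt0 _)).
  have sq1 := branch_sine_sqr (v := fun=> vp) (ll e) (fun=> lexx vp).
  rewrite /branch_sine send_ll recv_ll !extL in sq1.
  apply: le_trans (ler_wpM2l (ltW vp_gt0) (cos_defect_le_sqr sq1)) _.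
  have -> : vp * (flow_ratio (ll e) / (vp * vp)) ^+ 2 =
    flow_ratio (ll e) ^+ 2 / vp * (vp ^+ 2)^-1 by field; rewrite gt_eqF.
  rewrite mulrAC -mulrA [leRHS]mulrC ler_wpM2l ?sqr_ge0 //.
  rewrite ler_wpM2r ?invr_ge0 ?(ltW vp_gt0) //.
  by rewrite -[leRHS]invrK lef_pV2 ?posrE ?exprn_gt0 ?invr_gt0 //; nra.
- rewrite send_gl eq_lrshift mul0r add0r extG mulr1 mulrCA mulrA mulrC.
  apply: ler_wpM2r; first exact: mulr_ge0 (ler0n _ _) (ltW (stiffness_gt0 _)).
  apply: cos_defect_le; rewrite -[leLHS]real_normK ?num_real //.
  rewrite ler_pXn2r ?nnegrE ?normr_ge0 //; first exact: branch_sine_gl.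
  by have [_ /andP[]] := sine_bounds.
Qed.

(** The map is nondecreasing because [load_loss] and S^-1 both reverse the order.
    The lower end of the box comes from [load_loss_floor] and the choice of v_+,
    the upper end from w >= 0. *)
Lemma loss_fixpoint : exists2 v : 'I_n -> R,
  (forall k, vp <= v k <= 1) &
  forall k, v k = 1 + 4^-1 * (invmx S *m load_loss v) k 0.
Proof.
have SU : S \in unitmx.
  by apply: negative_definite_unit; apply: Smx_negative.
have antitone := @invS_antitone _ _ _ _ _ _ _ Nax BLL_neg _ VG_gt0 m_gt0.
have [_ vp1 _ vp_le] := vp_bounds.
pose F (v : 'I_n -> R) k : R := 1 + 4^-1 * (invmx S *m load_loss v) k 0.
have [||||v v_box vF] := @box_fixpoint R 'I_n (fun=> vp) (fun=> 1) F.
- by [].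
- move=> u v u_ge uv v_le k; rewrite /F lerD2l ler_pM2l ?invr_gt0 //.
  by apply: antitone; apply: load_loss_antitone.
- move=> k; apply: le_trans vp_le _.
  have := antitone _ _ load_loss_floor k.
  rewrite mulmxBr -!scalemxAr mulKmx // => h.
  have d := mx_entry_le_norm (invmx S *m effective_load) k 0.
  rewrite -DeltaE in d; have {d} /ler_normlP[_ d] := d.
  have : - vp^-1 * Delta N P VG QL - 4 * cos_defect (Ggl / vp) <=
      (invmx S *m load_loss (fun=> vp)) k 0.
    apply: le_trans h; rewrite sub_entry !scale_entry [ones _ _]mxE mulr1 lerD2r.
    rewrite !mulNr -mulrN -[leRHS]mulrN ler_pM2l ?invr_gt0 //; lra.
  rewrite /F invfM => h'; lra.
- move=> k; rewrite /F gerDl pmulr_rle0 ?invr_gt0 //.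
  have := antitone 0 (load_loss (fun=> 1)) _ k; rewrite mulmx0 [X in _ <= X]mxE.
  by apply=> l; rewrite mxE load_loss_ge0.
by exists v => // k; rewrite -[LHS]/(v k) -{1}vF.
Qed.

Definition load_voltage (v : 'I_n -> R) : 'cV[R]_n :=
  \col_k (VLstar N VG k 0 * v k).

Lemma voltageE v i : col_mx (load_voltage v) VG i 0 = U i 0 * ext v i.
Proof.
case: (split_ordP i) => k ->; first by rewrite col_mxEu mxE VstarL extL.
by rewrite col_mxEd VstarG extG mulr1.
Qed.

(** The active equations say that the flow V_i V_j B_ij sin eta_e is p_e on every
    branch.  In the reactive ones cos = 1 - (1 - cos) splits the sum at load k
    into the branch losses and V_k times entry k of B_LL V_L + B_LG V_G.  The
    latter is linear in v - 1, and the fixed point equation gives its value. *)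
Lemma fixpoint_solution (theta : 'cV[R]_(n + m)) (v : 'I_n -> R) :
  incidence N *m branch_flow N P = P ->
  (forall k, vp <= v k) ->
  (forall k, v k = 1 + 4^-1 * (invmx S *m load_loss v) k 0) ->
  (forall e, theta (snd e) 0 - theta (rcv e) 0 = asin (branch_sine v e)) ->
  PF_solution N P VG QL theta (load_voltage v).
Proof.
move=> flowE v_ge v_fix thetaE.
have SU : S \in unitmx by apply: negative_definite_unit; apply: Smx_negative.
have v_gt0 k : 0 < v k by exact: lt_le_trans vp_gt0 (v_ge k).
have ext_gt0 i : 0 < ext v i by exact: lt_le_trans vp_gt0 (ext_ge _ v_ge).
have sine_itv e : -1 <= branch_sine v e <= 1.
  by rewrite -ler_norml ltW // branch_sine_lt1.
have sinE e : sin (theta (snd e) 0 - theta (rcv e) 0) = branch_sine v e.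
  by rewrite thetaE asinK ?in_itv /=.
have cosE e : 1 - cos (theta (snd e) 0 - theta (rcv e) 0) =
    cos_defect (branch_sine v e) by rewrite thetaE cos_asin.
have sumN := @sum_neighbours _ _ _ _ _ _ _ Nax.
split=> [k|V i|V k].
- by rewrite mxE mulr_gt0 // -VstarL U_gt0.
- rewrite (sumN i) => [|j nij]; last first.
    have [->|ij] := eqVneq i j; first by rewrite subrr sin0 mulr0.
    by rewrite Bmx_unjoined // mulr0 mul0r.
  rewrite -[in LHS]flowE incidenceE; apply: eq_bigr => e _.
  have flow_e : branch_flow N P e 0 = V (snd e) 0 * V (rcv e) 0
      * B (snd e) (rcv e) * branch_sine v e.
    rewrite /V !voltageE /branch_sine /flow_ratio /stiffness; field.
    by rewrite !gt_eqF ?U_gt0 ?ext_gt0 // Bmx_joined ?joined_ends.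
  rewrite mulrBl; congr (_ + _).
    by have [->|_] := eqVneq i (snd e); rewrite ?mul0r // !mul1r sinE.
  have [->|_] := eqVneq i (rcv e); rewrite ?mul0r ?oppr0 // !mul1r.
  rewrite -(opprB (theta (snd e) 0)) sinN sinE flow_e.
  by rewrite Bmx_sym // (mulrC (V (rcv e) 0)) mulrN.
- pose f j := V (lshift m k) 0 * V j 0 * B (lshift m k) j.
  pose c j := cos (theta (lshift m k) 0 - theta j 0).
  have fc : \sum_j f j * (1 - c j) = v k * (load_loss v k 0 + QL k 0 / v k).
    rewrite (sumN (lshift m k)) => [|j nij]; last first.
      rewrite /f /c; have [->|ij] := eqVneq (lshift m k) j.
        by rewrite subrr cos0 subrr mulr0.
      by rewrite Bmx_unjoined // mulr0 mul0r.
    rewrite mxE mulNr addrAC addNr add0r big_distrr /=; apply: eq_bigr => e _.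
    rewrite [in RHS]mulrDl 2![in RHS]mulrDr /f /c /V /stiffness; congr (_ + _).
      have [kE|_] := eqVneq (lshift m k) (snd e); last by rewrite !mul0r !mulr0.
      by rewrite !voltageE !mul1r kE cosE -kE extL; ring.
    have [kE|_] := eqVneq (lshift m k) (rcv e); last by rewrite !mul0r !mulr0.
    have vk : ext v (rcv e) = v k by rewrite -kE extL.
    rewrite !voltageE !mul1r kE vk -(opprB (theta (snd e) 0)) cosN cosE.
    by rewrite (Bmx_sym Nax (rcv e)); ring.
  have f1 : \sum_j f j = v k * load_loss v k 0.
    pose x : 'cV[R]_n := 4^-1 *: (invmx S *m load_loss v).
    have Sx : (S *m x) k 0 = 4^-1 * load_loss v k 0.
      by rewrite -scalemxAr mulKVmx // scale_entry.
    have VE : load_voltage v =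
        VLstar N VG + \col_j (VLstar N VG j 0 * x j 0).
      apply/matrixP => j z; rewrite ord1 [LHS]mxE [RHS]mxE [X in _ + X]mxE.
      by rewrite scale_entry v_fix mulrDr mulr1.
    rewrite /f; under eq_bigr do rewrite -mulrA (mulrC _ (B _ _)).
    rewrite -big_distrr /= load_row VE mulmxDr BLL_VLstar //.
    move: Sx; rewrite SmxE => /(mulfI _) Sx.
    rewrite [(_ + _ : 'cV_ _) k 0]mxE [(- _ : 'cV_ _) k 0]mxE addrAC addNr add0r.
    by rewrite voltageE extL VstarL mulrAC Sx ?invr_eq0 // mulrC.
  have -> : \sum_j f j * c j = \sum_j f j - \sum_j f j * (1 - c j).
    by rewrite -sumrB; apply: eq_bigr => j _; ring.
  by rewrite fc f1; field; rewrite gt_eqF.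
Qed.

End FixedPoint.

Theorem theoremV2 (R : realType) (n m kll kgl kgg : nat)
    (n_gt0 : (0 < n)%N) (m_gt0 : (0 < m)%N)
    (N : network R n m kll kgl kgg)
    (N_network : network_axioms N) (N_radial : radial N)
    (BLL_negative : negative_definite (BLL N))
    (P : 'cV[R]_(n + m)) (VG : 'cV[R]_m) (QL : 'cV[R]_n)
    (P_balanced : \sum_i P i 0 = 0)
    (VG_gt0 : forall g, 0 < VG g 0)
    (QL_le0 : forall i, QL i 0 <= 0)
    (h_gl : Delta N P VG QL + 4 * Gamma_gl N P VG ^+ 2 < 1)
    (h_ll : Gamma_ll N P VG < 4^-1)
    (h_gg : Gamma_gg N P VG < 1) :
  let vp := v_plus N P VG QL in
  2^-1 < vp <= 1 /\
  exists gamma_ll gamma_gl gamma_gg : R,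
    [/\ 0 <= gamma_ll < pi / 2, 0 <= gamma_gl < pi / 4
      & 0 <= gamma_gg < pi / 2] /\
    [/\ sin gamma_ll = Gamma_ll N P VG / vp ^+ 2,
        sin gamma_gl = Gamma_gl N P VG / vp
      & sin gamma_gg = Gamma_gg N P VG] /\
    exists (theta : 'cV[R]_(n + m)) (VL : 'cV[R]_n),
      [/\ PF_solution N P VG QL theta VL,
          forall i, vp <= VL i 0 / VLstar N VG i 0 <= 1,
          forall e : 'I_kll,
            `|branch_angle N theta (ll_idx kgl kgg e)| <= gamma_ll,
          forall e : 'I_kgl,
            `|branch_angle N theta (gl_idx kll kgg e)| <= gamma_gl
        & forall e : 'I_kgg,
            `|branch_angle N theta (gg_idx kll kgl e)| <= gamma_gg].
Proof.
move=> vp.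
have [vp2 vp1 vp_gl _] := vp_bounds h_gl.
have [/andP[ll0 ll1] /andP[gl0 gl1] /andP[gg0 gg1]] :=
  sine_bounds h_gl h_ll h_gg.
rewrite -/vp in vp2 vp1 vp_gl ll0 ll1 gl0 gl1; split; first by rewrite vp2.
exists (asin (Gamma_ll N P VG / vp ^+ 2)), (asin (Gamma_gl N P VG / vp)).
exists (asin (Gamma_gg N P VG)).
have asin_ge0 (g : R) : 0 <= g -> g < 1 -> 0 <= asin g.
  by move=> g0 /ltW g1; apply: le_trans (norm_asin_le (x := 0) _ g1); rewrite ?normr0.
have asinI (g : R) : 0 <= g -> g < 1 -> sin (asin g) = g.
  by move=> g0 g1; rewrite asinK // in_itv /=; lra.
have asin_pi2 (g : R) : 0 <= g -> g < 1 -> asin g < pi / 2.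
  by move=> g0 g1; apply: asin_ltpi2; lra.
split; first by split; rewrite asin_ge0 ?asin_pi2 ?asin_lt_pi4.
split; first by split; apply: asinI.
have [v v_box v_fix] :=
  loss_fixpoint N_network BLL_negative VG_gt0 m_gt0 QL_le0 h_gl h_ll h_gg.
have v_ge k : vp <= v k by case/andP: (v_box k).
have [theta thetaE] := radial_potential N_network N_radial
  (\col_e asin (branch_sine N P VG v e)).
have {}thetaE e : theta (send N e) 0 - theta (recv N e) 0 =
    asin (branch_sine N P VG v e) by rewrite thetaE mxE.
have angle e g : `|branch_sine N P VG v e| <= g -> g < 1 ->
    `|branch_angle N theta e| <= asin g.
  move=> eg g1; rewrite /branch_angle thetaE principal_angle_id.
    by apply: norm_asin_le; rewrite // ltW.
  have e_itv : -1 <= branch_sine N P VG v e <= 1.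
    by rewrite -ler_norml (le_trans eg) // ltW.
  have := asin_geNpi2 e_itv; have := asin_lepi2 e_itv.
  by have := pi_gt0 R; lra.
exists theta, (load_voltage N VG v); split.
- apply: fixpoint_solution => //; exact: incidence_branch_flow.
- move=> i; rewrite mxE mulrAC divff ?mul1r //.
  by rewrite -VstarL gt_eqF // Vstar_gt0.
- by move=> e; apply: angle => //; apply: branch_sine_ll.
- by move=> e; apply: angle => //; apply: branch_sine_gl.
- by move=> e; apply: angle => //; apply: branch_sine_gg.
Qed.
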